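(* Assume that the Banach space $Y$ contains good $\ell_\infty$-trees of arbitrary height almost isometrically. Then for every $\varepsilon>0$ and every $k\in\mathbb{N}$ there exists a map $\Psi_k\colon D_k^\omega\to Y$ such that, if $x$ and $y$ belong to the same vertical path, then $$d_k(x,y)\le\|\Psi_k(x)-\Psi_k(y)\|\le(1+\varepsilon)d_k(x,y),$$ and if $x$ and $y$ do not belong to the same vertical path, then $$\frac{d_k(x,y)}{C(\varepsilon)}\le\|\Psi_k(x)-\Psi_k(y)\|\le(1+\varepsilon)d_k(x,y),$$ where $C(\varepsilon)=6(1+\varepsilon)$. Moreover, if $Y$ contains good $\ell_\infty$-trees of arbitrary height almost isometrically in such a way that (for every $\eta>0$, every height $n$ and every compatible linear ordering $(A_i)_{i\in\mathbb{N}}$ of $[\mathbb{N}]^{\le n}$) the vector-tree $(y_A)_{A\in[\mathbb{N}]^{\le n}}$ of the $(1+\eta,1+\eta)$-good tree can be chosen so that the sequence $(y_{A_i})_{i\in\mathbb{N}}$ is bimonotone, then for every $\varepsilon>0$ and every $k\in\mathbb{N}$ the map $\Psi_k\colon D_k^\omega\to Y$ can be chosen so that, if $x$ and $y$ belong to the same vertical path, then $$d_k(x,y)\le\|\Psi_k(x)-\Psi_k(y)\|\le(1+\varepsilon)d_k(x,y),$$ and if $x$ and $y$ do not belong to the same vertical path, then $$\frac{d_k(x,y)}{3}\le\|\Psi_k(x)-\Psi_k(y)\|\le(1+\varepsilon)d_k(x,y).$$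
   Context: Countably branching diamond graphs: $D_0^\omega$ is the graph with two vertices $b,t$ joined by an edge. For $k\ge 0$, $D_{k+1}^\omega$ is obtained from $D_k^\omega$ by removing each edge $\{u,v\}$ and adding instead a countably infinite set of new vertices (disjoint sets for distinct edges), each joined by an edge to $u$ and to $v$ and to nothing else. $d_k$ is the shortest path metric on (the vertex set of) $D_k^\omega$, edges having length one. Two vertices of $D_k^\omega$ belong to the same vertical path if they are the endpoints of a path in $D_k^\omega$ along which $d_k(b,\cdot)$ is strictly increasing (from one of them to the other). $[\mathbb{N}]^{\le n}$ is the set of subsets of $\mathbb{N}=\{1,2,\dots\}$ with at most $n$ elements (including $\emptyset$), $[\mathbb{N}]^n$ those with exactly $n$ elements, written in increasing order; $\max(\emptyset):=0$. An enumeration $(A_i)_{i\in\mathbb{N}}$ of $[\mathbb{N}]^{\le n}$ is a compatible linear ordering if $\max(A_i)<\max(A_j)$ implies $i<j$. A Banach space $X$ contains $(C,D)$-good $\ell_\infty$-trees of arbitrary height ($C,D\ge1$) if for any $n\in\mathbb{N}$ and any compatible linear ordering $(A_i)_{i\in\mathbb{N}}$ of $[\mathbb{N}]^{\le n}$ there are a vector-tree $(x_A)_{A\in[\mathbb{N}]^{\le n}}$ in the unit sphere $S_X$ and a functional-tree $(x_A^* )_{A\in[\mathbb{N}]^{\le n}}$ in $S_{X^*}$ such that: (a) $x_A^*(x_A)=1$ and $x_A^*(x_B)=0$ for all $A,B\in[\mathbb{N}]^{\le n}$ with $\max(B)>\max(A)$; (b) $\frac1C\|(a_i)_{i=0}^n\|_\infty\le\|a_0x_\emptyset+a_1x_{\{b_1\}}+\cdots+a_nx_{\{b_1,\dots,b_n\}}\|\le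 C\|(a_i)_{i=0}^n\|_\infty$ for all $(a_i)_{i=0}^n\subset\mathbb{R}$ and all $\{b_1<\dots<b_n\}\in[\mathbb{N}]^n$; (c) $\|\sum_{m=1}^ia_mx_{A_m}\|\le D\|\sum_{m=1}^ja_mx_{A_m}\|$ for all $i\le j$ and all real $(a_m)_{m=1}^j$. $X$ contains good $\ell_\infty$-trees of arbitrary height almost isometrically if it contains $(1+\varepsilon,1+\varepsilon)$-good $\ell_\infty$-trees of arbitrary height for every $\varepsilon>0$. A basic sequence $(y_i)$ is bimonotone if $\|\sum_{j=m}^na_jy_j\|\le\|\sum_{j=1}^Na_jy_j\|$ for all $1\le m\le n\le N$ and all scalars $a_j$. *)

(* Defs.v *)
From mathcomp Require Export all_boot all_order all_algebra finmap.
From mathcomp Require Export boolp classical_sets functions reals topology.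
From mathcomp Require Export normedtype.

Set Implicit Arguments.
Unset Strict Implicit.
Unset Printing Implicit Defensive.

Export Order.TTheory GRing.Theory Num.Theory.
Export numFieldNormedType.Exports.

Local Open Scope classical_set_scope.
Local Open Scope ring_scope.

(** * Graphs and the shortest path metric *)

(* A graph is given by its edges and their two endpoints; the order of the two
   endpoints is only bookkeeping, since [adjacent] is symmetric. *)
Record graph := Graph {
  vertex : Type;
  edge : Type;
  end1 : edge -> vertex;
  end2 : edge -> vertex }.

Definition adjacent (G : graph) : rel (vertex G) := fun u v =>
  `[< exists e : edge G,
        (u = end1 e /\ v = end2 e) \/ (u = end2 e /\ v = end1 e) >].

Definition path_of_length (G : graph) (u v : vertex G) (n : nat) : Prop :=
  exists s : seq (vertex G),
    [/\ path (@adjacent G) u s, last u s = v & size s = n].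

(* The least length of a path from [u] to [v]; the default value 0 is only
   taken when there is no such path, which does not happen in the (connected)
   diamond graphs. *)
Definition graph_dist (G : graph) (u v : vertex G) : nat :=
  xget 0%N [set n | path_of_length u v n /\
                    forall m, path_of_length u v m -> (n <= m)%N].

(** * Countably branching diamond graphs *)

(* Each edge [e] is replaced by the new vertices [inr (e, i)], [i : nat]; the
   new edge [(e, i, false)] joins [end1 e] to [inr (e, i)] and the new edge
   [(e, i, true)] joins [inr (e, i)] to [end2 e]. *)
Definition omega_subdivision (G : graph) : graph :=
  {| vertex := (vertex G + edge G * nat)%type;
     edge := (edge G * nat * bool)%type;
     end1 := fun f => let: (e, i, h) := f in
                      if h then inr (e, i) else inl (end1 e);
     end2 := fun f => let: (e, i, h) := f in
                      if h then inl (end2 e) else inr (e, i) |}.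

(* The two vertices of D_0 are b = [false] and t = [true]. *)
Definition single_edge : graph :=
  {| vertex := bool; edge := unit;
     end1 := fun=> false; end2 := fun=> true |}.

Fixpoint diamond (k : nat) : graph :=
  if k is k'.+1 then omega_subdivision (diamond k') else single_edge.

Fixpoint diamond_bottom (k : nat) : vertex (diamond k) :=
  if k is k'.+1 then inl (diamond_bottom k') else false.

Definition diamond_dist (k : nat) (x y : vertex (diamond k)) : nat :=
  graph_dist x y.

Definition ascending_path (k : nat) (x y : vertex (diamond k)) : Prop :=
  exists s : seq (vertex (diamond k)),
    path (fun u v => adjacent u v &&
            (diamond_dist (diamond_bottom k) u
               < diamond_dist (diamond_bottom k) v)%N) x s /\
    last x s = y.

Definition same_vertical_path (k : nat) (x y : vertex (diamond k)) : Prop :=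
  ascending_path x y \/ ascending_path y x.

(** * Finite subsets of {1, 2, ...} and compatible linear orderings *)

(* The natural numbers of the tree index sets start at 1, so that the maximum
   of the empty set, 0, is smaller than that of any nonempty set. *)
Definition subsets_le (n : nat) : set {fset nat} :=
  [set A : {fset nat} | (0%N \notin A) /\ (#|` A| <= n)%N].

Definition fset_max (A : {fset nat}) : nat := (\max_(i <- A) i)%N.

(* The enumeration is indexed from 0 instead of 1. *)
Definition compatible_ordering (n : nat) (A : nat -> {fset nat}) : Prop :=
  set_bij [set: nat] (subsets_le n) A /\
  forall i j, (fset_max (A i) < fset_max (A j))%N -> (i < j)%N.

(** * Banach space notions *)

Definition dual_norm (R : realType) (X : normedModType R) (f : X -> R^o) : R :=
  sup [set `|f v| | v in [set v : X | `|v| <= 1]].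

Definition dual_unit_sphere (R : realType) (X : normedModType R) :
    set {linear X -> R^o} :=
  [set f | continuous f /\ dual_norm f = 1].

Definition seq_span (R : realType) (X : normedModType R) (y : nat -> X) :
    set X :=
  [set v | exists (N : nat) (a : nat -> R), v = \sum_(j < N) a j *: y j].

(* [y] is a Schauder basis of its closed linear span. *)
Definition basic_sequence (R : realType) (X : normedModType R)
    (y : nat -> X) : Prop :=
  forall v : X, closure (seq_span y) v ->
    exists! a : nat -> R, (fun N : nat => \sum_(j < N) a j *: y j) @ \oo --> v.

Definition bimonotone (R : realType) (X : normedModType R)
    (y : nat -> X) : Prop :=
  basic_sequence y /\
  forall (a : nat -> R) (m n N : nat), (m < n)%N -> (n <= N)%N ->
    `|\sum_(m <= j < n) a j *: y j| <= `|\sum_(0 <= j < N) a j *: y j|.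

(** * Good l_infty-trees *)

(* [x] and [xs] are only relevant on [subsets_le n]. In [good_branches], the
   list [b] enumerates an n-element set {b_1 < ... < b_n} of positive integers
   in increasing order ([path ltn 0 b]) and [take i b] lists {b_1, ..., b_i}. *)
Record good_linf_tree (R : realType) (X : normedModType R) (C D : R) (n : nat)
    (A : nat -> {fset nat}) (x : {fset nat} -> X)
    (xs : {fset nat} -> {linear X -> R^o}) : Prop := {
  good_vectors : forall B, subsets_le n B -> `|x B| = 1;
  good_functionals : forall B, subsets_le n B -> dual_unit_sphere (xs B);
  good_diagonal : forall B, subsets_le n B -> xs B (x B) = 1;
  good_vanishing : forall B B', subsets_le n B -> subsets_le n B' ->
    (fset_max B < fset_max B')%N -> xs B (x B') = 0;
  good_branches : forall (a : nat -> R) (b : seq nat),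
    path ltn 0%N b -> size b = n ->
    let a_norm := \big[Num.max/0]_(i < n.+1) `|a i| in
    let v := \sum_(i < n.+1) a i *: x [fset c in take i b]%fset in
    C^-1 * a_norm <= `|v| /\ `|v| <= C * a_norm;
  good_basis : forall (a : nat -> R) (i j : nat), (i <= j)%N ->
    `|\sum_(m < i) a m *: x (A m)| <= D * `|\sum_(m < j) a m *: x (A m)| }.

Definition contains_good_linf_trees (R : realType) (X : normedModType R)
    (C D : R) : Prop :=
  forall (n : nat) (A : nat -> {fset nat}), (0 < n)%N ->
    compatible_ordering n A ->
    exists (x : {fset nat} -> X) (xs : {fset nat} -> {linear X -> R^o}),
      good_linf_tree C D n A x xs.

Definition contains_good_linf_trees_almost_isometrically
    (R : realType) (X : normedModType R) : Prop :=
  forall eps : R, 0 < eps -> contains_good_linf_trees X (1 + eps) (1 + eps).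

Definition contains_bimonotone_good_linf_trees_almost_isometrically
    (R : realType) (X : normedModType R) : Prop :=
  forall eta : R, 0 < eta ->
  forall (n : nat) (A : nat -> {fset nat}), (0 < n)%N ->
    compatible_ordering n A ->
    exists (x : {fset nat} -> X) (xs : {fset nat} -> {linear X -> R^o}),
      good_linf_tree (1 + eta) (1 + eta) n A x xs /\ bimonotone (x \o A).

(* Main.v *)
Require Import Defs.
From mathcomp Require Import zify lra.

(* Take a good tree of height k. Every edge e of D_k is labelled by k natural
   numbers, hence by a branch of the tree. Set Psi(b) = 0, Psi(t) = x_0 (the root
   vector); when D_k is subdivided, double the old values and send the i-th new
   vertex on the edge {u, v} to Psi(u) + Psi(v) + x_l, where l is the label of
   the new edges at that vertex. The images of the two ends of an edge then
   differ by a combination of the vectors of one branch with coefficients in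
   [-1, 1], which gives the upper bound by the triangle inequality. The
   coefficient on x_0 is the height d(b, .), and x_0^* reads it off, which gives
   the lower bound on vertical paths and |h(x) - h(y)| <= N := |Psi x - Psi y|
   in general. If x and y are not on a vertical path, they lie on two different
   branches between the ends v0, v1 of an edge of some D_j. Tail projections
   (of norm K <= 2 + eps, or 1 in the bimonotone case) followed by a functional
   of the tree extract the coefficient of x or of y on its own branch, which is
   its distance r to v0 or v1. So r <= K N, and going through that vertex
   d(x, y) <= 2 r + |h(x) - h(y)| <= (2 K + 1) N. *)

Set Implicit Arguments.
Unset Strict Implicit.
Unset Printing Implicit Defensive.

(** * Labels and coefficients in diamond graphs *)

(** Adding [i.+1] to the last entry keeps labels strictly increasing and positive, so a label lists
    a finite set, and different [i] give different labels. Both halves of a subdivided path share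
    one label. *)
Fixpoint edge_label (k : nat) : edge (diamond k) -> seq nat :=
  match k return edge (diamond k) -> seq nat with
  | 0 => fun=> [::]
  | k'.+1 => fun f : edge (diamond k') * nat * bool =>
      let: (e, i, _) := f in
      rcons (edge_label e) (last 0 (edge_label e) + i.+1)
  end.

(* [coef x l] is the coefficient of the image of [x] on the tree vector indexed
   by the set with increasing enumeration [l]. *)
Fixpoint coef (k : nat) : vertex (diamond k) -> seq nat -> nat :=
  match k return vertex (diamond k) -> seq nat -> nat with
  | 0 => fun (v : bool) l => v && nilp l
  | k'.+1 => fun (v : vertex (diamond k') + edge (diamond k') * nat) l =>
      match v with
      | inl u => (coef u l).*2
      | inr (e, i) => coef (end1 e) l + coef (end2 e) l +
          (l == rcons (edge_label e) (last 0 (edge_label e) + i.+1))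
      end
  end.

(** The coefficient on the root vector; it is shown below to be the distance from the bottom
    vertex. *)
Definition level (k : nat) (v : vertex (diamond k)) : nat := coef v [::].

Lemma rcons_neq0 (T : eqType) (s : seq T) x : ([::] == rcons s x) = false.
Proof. by case: s. Qed.

Lemma size_edge_label k (e : edge (diamond k)) : size (edge_label e) = k.
Proof. by elim: k e => [|k IHk] //= [[e i] h] /=; rewrite size_rcons IHk. Qed.

Lemma edge_label_increasing k (e : edge (diamond k)) :
  path ltn 0 (edge_label e).
Proof.
elim: k e => [|k IHk] //= [[e i] h] /=.
by rewrite rcons_path IHk /= addnS ltnS leq_addr.
Qed.

Lemma level_edge k (e : edge (diamond k)) :
  level (end2 e) = (level (end1 e)).+1.
Proof.
rewrite /level; elim: k e => [|k IHk] //= [[e i] [|]] /=.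
all: by rewrite rcons_neq0 IHk; lia.
Qed.

(** This places both ends of an edge on one branch of the tree: a new vertex adds only its own label
    to the labels inherited from the subdivided edge. *)
Lemma coef_prefix k (e : edge (diamond k)) l :
  0 < coef (end1 e) l + coef (end2 e) l -> prefix l (edge_label e).
Proof.
elim: k e l => [|k IHk] /= e l; first by case: l.
case: e => [[e i] h] h0.
have [->|nl] := eqVneq l (rcons (edge_label e) (last 0 (edge_label e) + i.+1)).
  exact: prefix_refl.
apply: prefix_trans (prefix_rcons _ _); apply: (IHk e).
by case: h h0 => /=; rewrite (negPf nl); lia.
Qed.

(** At the new label the coefficients are 0 and 1, since it is too long to occur among the old ones.
    At any other label, old coefficients c and c' become 2c or 2c' against c + c', so their gap
    stays |c - c'|. *)
Lemma coef_edge k (e : edge (diamond k)) l :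
  coef (end1 e) l <= (coef (end2 e) l).+1 /\
  coef (end2 e) l <= (coef (end1 e) l).+1.
Proof.
elim: k e l => [|k IHk] /= e l; first by split=> //; case: (nilp l).
case: e => [[e i] h].
have [->|nl] := eqVneq l (rcons (edge_label e) (last 0 (edge_label e) + i.+1)).
  set q := rcons _ _; have : ~~ (0 < coef (end1 e) q + coef (end2 e) q).
    by apply/negP=> /coef_prefix /size_prefix; rewrite size_rcons ltnn.
  by case: h => /=; rewrite eqxx; lia.
by have := IHk e l; case: h => /=; rewrite (negPf nl); lia.
Qed.

Lemma vertex_on_edge k (x : vertex (diamond k)) :
  exists e : edge (diamond k), x = end1 e \/ x = end2 e.
Proof.
elim: k x => [|k IHk] /=; first by case; exists tt; [right | left].
case=> [u|[e i]]; last by exists (e, i, true); left.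
have [e [->|->]] := IHk u; first by exists (e, 0, false); left.
by exists (e, 0, true); right.
Qed.

(** * Upward reachability, levels and the shortest path metric *)

(** An induction-friendly form of ascending paths that uses only the orientation of edges from
    [end1] to [end2], hence no distances. *)
Inductive climb k : vertex (diamond k) -> vertex (diamond k) -> Prop :=
| climb_refl x : climb x x
| climb_step (e : edge (diamond k)) y : climb (end2 e) y -> climb (end1 e) y.

Lemma climb_edge k (e : edge (diamond k)) : climb (end1 e) (end2 e).
Proof. exact/climb_step/climb_refl. Qed.

Lemma climb_trans k (x y z : vertex (diamond k)) :
  climb x y -> climb y z -> climb x z.
Proof. by elim=> // e y' _ IH /IH; apply: climb_step. Qed.

Lemma climb_lower k (e : edge (diamond k)) i :
  @climb k.+1 (inl (end1 e)) (inr (e, i)).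
Proof. exact: (@climb_edge k.+1 (e, i, false)). Qed.

Lemma climb_upper k (e : edge (diamond k)) i :
  @climb k.+1 (inr (e, i)) (inl (end2 e)).
Proof. exact: (@climb_edge k.+1 (e, i, true)). Qed.

(** Each old edge is replaced by the detour through its new vertex number 0. *)
Lemma climb_inl k (x y : vertex (diamond k)) :
  climb x y -> @climb k.+1 (inl x) (inl y).
Proof.
elim=> [x'|e y' _ IH]; first exact: climb_refl.
by apply: climb_trans (climb_lower e 0) _; apply: climb_trans (climb_upper e 0) _.
Qed.

Lemma climb_bottom k (x : vertex (diamond k)) : climb (diamond_bottom k) x.
Proof.
elim: k x => [|k IHk].
  by case; [exact: (@climb_edge 0 tt) | exact: climb_refl].
case=> [u|[e i]]; first exact: (climb_inl (IHk u)).
exact: climb_trans (climb_inl (IHk _)) (climb_lower e i).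
Qed.

Lemma level_bottom k : level (diamond_bottom k) = 0.
Proof. by rewrite /level; elim: k => //= k ->. Qed.

Lemma adjacent_sym (G : graph) (u v : vertex G) : adjacent u v = adjacent v u.
Proof. by apply: asbool_equiv_eq; split=> -[e H]; exists e; tauto. Qed.

Lemma adjacent_edge (G : graph) (e : edge G) : adjacent (end1 e) (end2 e).
Proof. by apply/asboolP; exists e; left. Qed.

Section Paths.
Variable G : graph.
Implicit Types u v w : vertex G.

Lemma path_of_length0 u : path_of_length u u 0.
Proof. by exists [::]. Qed.

Lemma path_of_length1 u v : adjacent u v -> path_of_length u v 1.
Proof. by move=> uv; exists [:: v]; rewrite /= uv. Qed.

Lemma path_of_length_trans u v w m n :
  path_of_length u v m -> path_of_length v w n -> path_of_length u w (m + n).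
Proof.
move=> [s [us sv <-]] [t [vt tw <-]]; exists (s ++ t).
by rewrite cat_path us last_cat sv size_cat.
Qed.

Lemma path_of_length_sym u v n : path_of_length u v n -> path_of_length v u n.
Proof.
move=> [s [us sv <-]]; elim: s u us sv => [|w s IHs] u /=.
  by move=> _ ->; exact: path_of_length0.
move=> /andP[uw ws] sv; rewrite -addn1; apply: path_of_length_trans (IHs _ ws sv) _.
by apply: path_of_length1; rewrite adjacent_sym.
Qed.

Lemma graph_dist_le u v n : path_of_length u v n -> graph_dist u v <= n.
Proof.
rewrite /graph_dist => uvn; case: xgetP => [m _ [_ min_m]|_]; first exact: min_m.
by [].
Qed.

(** Once some path exists, a least length exists too, so the default value of [graph_dist] is not
    taken. *)
Lemma path_graph_dist u v n :
  path_of_length u v n -> path_of_length u v (graph_dist u v).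
Proof.
move=> uvn; have ex : exists m, `[< path_of_length u v m >].
  by exists n; exact/asboolP.
rewrite /graph_dist; case: xgetP => [m _ []//|none].
case: (ex_minnP ex) => m /asboolP uvm min_m; case: (none m); split=> // j uvj.
exact/min_m/asboolP.
Qed.
End Paths.

Lemma level_adjacent k (u v : vertex (diamond k)) : adjacent u v ->
  level v = (level u).+1 \/ level u = (level v).+1.
Proof.
by move=> /asboolP[e [[-> ->]|[-> ->]]]; rewrite level_edge; [left | right].
Qed.

Lemma level_path k (u v : vertex (diamond k)) n :
  path_of_length u v n -> level v <= level u + n.
Proof.
move=> [s [us sv <-]]; elim: s u us sv => [|w s IHs] u /=.
  by move=> _ ->; rewrite addn0.
by move=> /andP[/level_adjacent uw ws] /(IHs _ ws); lia.
Qed.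

Lemma climb_level k (x y : vertex (diamond k)) : climb x y -> level x <= level y.
Proof. by elim=> // e z _; rewrite level_edge; apply: ltnW. Qed.

Lemma climb_path k (x y : vertex (diamond k)) :
  climb x y -> path_of_length x y (level y - level x).
Proof.
elim=> [z|e z ez IH]; first by rewrite subnn; exact: path_of_length0.
have -> : level z - level (end1 e) = 1 + (level z - level (end2 e)).
  by have := climb_level ez; rewrite level_edge; lia.
exact: path_of_length_trans (path_of_length1 (adjacent_edge e)) IH.
Qed.

(** Climbing from the bottom gives a path of length [level x]; no path is shorter, because the level
    changes by one along each edge. *)
Lemma diamond_dist_bottom k (x : vertex (diamond k)) :
  diamond_dist (diamond_bottom k) x = level x.
Proof.
have bx := climb_path (climb_bottom x).
apply/eqP; rewrite eqn_leq; apply/andP; split.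
  by rewrite -[level x]subn0 -(level_bottom k) graph_dist_le.
by have := level_path (path_graph_dist bx); rewrite level_bottom.
Qed.

Lemma diamond_connected k (x y : vertex (diamond k)) :
  path_of_length x y (diamond_dist x y).
Proof.
have bx := climb_path (climb_bottom x); have bY := climb_path (climb_bottom y).
exact: path_graph_dist (path_of_length_trans (path_of_length_sym bx) bY).
Qed.

Lemma diamond_dist_sym k (x y : vertex (diamond k)) :
  diamond_dist x y = diamond_dist y x.
Proof.
by apply/eqP; rewrite eqn_leq !graph_dist_le //; apply/path_of_length_sym/diamond_connected.
Qed.

Lemma climb_ascending k (x y : vertex (diamond k)) :
  climb x y -> ascending_path x y.
Proof.
elim=> [z|e z _ [s [es sz]]]; first by exists [::].
exists (end2 e :: s); rewrite /= es adjacent_edge !diamond_dist_bottom.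
by rewrite level_edge leqnn.
Qed.

(** Every step of an ascending path raises the level by exactly one, so its length is the difference
    of levels. *)
Lemma ascending_dist k (x y : vertex (diamond k)) :
  ascending_path x y -> level x + diamond_dist x y <= level y.
Proof.
move=> [s [xs sy]].
suff [ps <-] : path_of_length x y (size s) /\ level x + size s = level y.
  by rewrite leq_add2l graph_dist_le.
elim: s x xs sy => [|w s IHs] x /=.
  by move=> _ ->; rewrite addn0; split=> //; exact: path_of_length0.
rewrite !diamond_dist_bottom => /andP[/andP[xw lxw] ws] /(IHs _ ws)[pw lw].
split; first exact: path_of_length_trans (path_of_length1 xw) pw.
by have := level_adjacent xw; lia.
Qed.

(** * Branches and the relative position of two vertices *)

Definition comparable_label (l q : seq nat) : bool := prefix l q || prefix q l.

Definition in_branch k (v0 v1 : vertex (diamond k)) (q : seq nat)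
    (x : vertex (diamond k)) : Prop :=
  [/\ climb v0 x, climb x v1 &
      forall l, 0 < coef x l -> comparable_label l q].

(* Along an edge of the lower (upper) half of the branch, the coefficient of
   the label [q] of the branch is the height above [v0] (below [v1]). *)
Definition edge_in_branch k (v0 v1 : vertex (diamond k)) (q : seq nat)
    (e : edge (diamond k)) : Prop :=
  [/\ prefix q (edge_label e),
      in_branch v0 v1 q (end1 e), in_branch v0 v1 q (end2 e) &
      (coef (end1 e) q + level v0 = level (end1 e) /\
       coef (end2 e) q + level v0 = level (end2 e)) \/
      (coef (end1 e) q + level (end1 e) = level v1 /\
       coef (end2 e) q + level (end2 e) = level v1)].

Lemma coef_label_oversize k (x : vertex (diamond k)) l :
  k < size l -> coef x l = 0.
Proof.
move=> kl; have [e] := vertex_on_edge x.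
have : ~~ (0 < coef (end1 e) l + coef (end2 e) l).
  by apply/negP=> /coef_prefix /size_prefix; rewrite size_edge_label leqNgt kl.
by rewrite -leqNgt leqn0 addn_eq0 => /andP[/eqP ? /eqP ?] [->|->].
Qed.

Lemma level_inl k (u : vertex (diamond k)) :
  level (inl u : vertex (diamond k.+1)) = (level u).*2.
Proof. by []. Qed.

Lemma level_inr k (e : edge (diamond k)) i :
  level (inr (e, i) : vertex (diamond k.+1)) = (level (end1 e)).*2.+1.
Proof. by rewrite /level /= rcons_neq0 -!/(level _) level_edge; lia. Qed.

(** A branch is born as the two-edge path through one new vertex, whose coefficient 1 is both its
    height above [v0] and its depth below [v1]. *)
Lemma edge_in_branch_new k (e : edge (diamond k)) i h :
  @edge_in_branch k.+1 (inl (end1 e)) (inl (end2 e))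
    (@edge_label k.+1 (e, i, h)) (e, i, h).
Proof.
set q := @edge_label k.+1 (e, i, h).
have sq : k < size q by rewrite size_edge_label.
have q0 (u : vertex (diamond k)) : coef u q = 0 by apply: coef_label_oversize.
have cq f l : f = (e, i, h) ->
   0 < coef (@end1 (diamond k.+1) f) l + coef (@end2 (diamond k.+1) f) l ->
   comparable_label l q.
  by move=> -> /coef_prefix lq; rewrite /comparable_label lq.
split; first exact: prefix_refl.
- split; last by move=> l l0; apply: cq (erefl _) _; lia.
    by case: (h); [exact: climb_lower | exact: climb_refl].
  by case: (h); [exact: climb_upper | exact: climb_inl (climb_edge _)].
- split; last by move=> l l0; apply: cq (erefl _) _; lia.
    by case: (h); [exact: climb_inl (climb_edge _) | exact: climb_lower].
  by case: (h); [exact: climb_refl | exact: climb_upper].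
have ci : coef (inr (e, i) : vertex (diamond k.+1)) q = 1 by rewrite /= !q0 eqxx.
have cl (u : vertex (diamond k)) : coef (inl u : vertex (diamond k.+1)) q = 0 by rewrite /= q0.
have := level_edge e.
by case: (h); [right | left]; rewrite (ci, cl) (ci, cl) level_inr !level_inl; lia.
Qed.

(** Old coefficients at [q] and old levels both double, and at a new vertex both are the sum over
    the two ends of the edge, its own label being longer than [q]. The linear relations between them
    therefore survive. *)
Lemma edge_in_branch_subdivide k (v0 v1 : vertex (diamond k)) q e i h :
  edge_in_branch v0 v1 q e ->
  @edge_in_branch k.+1 (inl v0) (inl v1) q (e, i, h).
Proof.
move=> [qe [v01 v11 s1] [v02 v12 s2] c].
have qn : (q == rcons (edge_label e) (last 0 (edge_label e) + i.+1)) = false.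
  by apply/eqP=> qE; move/size_prefix: qe; rewrite qE size_rcons ltnn.
have bl u : climb v0 u -> climb u v1 ->
   (forall l, 0 < coef u l -> comparable_label l q) ->
   @in_branch k.+1 (inl v0) (inl v1) q (inl u).
  by move=> a b s; split; [exact: climb_inl | exact: climb_inl |];
    move=> l /= l0; apply: s; lia.
have bi : @in_branch k.+1 (inl v0) (inl v1) q (inr (e, i)).
  split; first exact: climb_trans (climb_inl v01) (climb_lower _ _).
    exact: climb_trans (climb_upper _ _) (climb_inl v12).
  move=> l /=; have [->|_ l0] := eqVneq l (rcons _ _).
    by rewrite /comparable_label (prefix_trans qe (prefix_rcons _ _)) orbT.
  by have [c1|/s1//] := posnP (coef (end1 e) l); apply: s2; lia.
split; first exact: prefix_trans qe (prefix_rcons _ _).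
- by case: h => //; exact: bl.
- by case: h => //; exact: bl.
have le := level_edge e.
have ci : coef (inr (e, i) : vertex (diamond k.+1)) q = coef (end1 e) q + coef (end2 e) q.
  by rewrite /= qn addn0.
have cl (u : vertex (diamond k)) :
    coef (inl u : vertex (diamond k.+1)) q = (coef u q).*2 by [].
by case: h; case: c => -[c1 c2]; [left|right|left|right];
  rewrite !(ci, cl (end1 e), cl (end2 e), level_inr, level_inl (end1 e),
    level_inl (end2 e), level_inl v0, level_inl v1); lia.
Qed.

(** By induction on the parent edges: an order relation lifts to the halves, and separated branches
    stay separated. Only a common parent needs a new argument. *)
Lemma edge_trichotomy k (e e' : edge (diamond k)) :
  [\/ e = e', climb (end2 e) (end1 e'), climb (end2 e') (end1 e) |
  exists v0 v1 (p : seq nat) (a b : nat), [/\ a != b, edge_in_branch v0 v1 (rcons p a) e &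
    edge_in_branch v0 v1 (rcons p b) e']].
Proof.
elim: k e e' => [|k IHk]; first by move=> [] []; apply: Or41.
have lift (e1 e2 : edge (diamond k)) i1 i2 h1 h2 : climb (end2 e1) (end1 e2) ->
    @climb k.+1 (@end2 (diamond k.+1) (e1, i1, h1))
      (@end1 (diamond k.+1) (e2, i2, h2)).
  move=> /climb_inl c.
  have c1 : @climb k.+1 (@end2 (diamond k.+1) (e1, i1, h1)) (inl (end2 e1)).
    by case: h1; [exact: climb_refl | exact: climb_upper].
  apply: climb_trans c1 (climb_trans c _).
  by case: h2; [exact: climb_lower | exact: climb_refl].
move=> [[e i] h] [[e' i'] h'].
case: (IHk e e') => [<-|c|c|[v0 [v1 [p [a [b [ab ea eb]]]]]]].
- have [<-|ii] := eqVneq i i'.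
    case: h h' => [] [].
    + exact: Or41.
    + apply: Or43; exact: climb_refl.
    + apply: Or42; exact: climb_refl.
    + exact: Or41.
  (* Distinct new vertices on one parent edge start two branches between its ends, with the label of
     the parent as common part. *)
  apply: Or44; exists (inl (end1 e)), (inl (end2 e)), (edge_label e).
  exists (last 0 (edge_label e) + i.+1), (last 0 (edge_label e) + i'.+1); split.
  + by rewrite eqn_add2l.
  + exact: edge_in_branch_new.
  + exact: edge_in_branch_new.
- by apply/Or42/lift.
- by apply/Or43/lift.
apply: Or44; exists (inl v0), (inl v1), p, a, b.
by split=> //; exact: edge_in_branch_subdivide.
Qed.

(* In the second case [x] and [y] lie on different branches [rcons p a] and
   [rcons p b] between two vertices v0 and v1. The coefficient of [x] on its own
   branch is its distance to v0 or to v1, and the two inequalities come from the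
   path from [x] to [y] through that vertex. *)
Lemma vertex_dichotomy k (x y : vertex (diamond k)) :
  same_vertical_path x y \/
  exists (p : seq nat) (a b : nat), [/\ a != b,
    forall l, 0 < coef x l -> comparable_label l (rcons p a),
    forall l, 0 < coef y l -> comparable_label l (rcons p b),
    diamond_dist x y + level x <= (coef x (rcons p a)).*2 + level y \/
    diamond_dist x y + level y <= (coef x (rcons p a)).*2 + level x &
    diamond_dist x y + level x <= (coef y (rcons p b)).*2 + level y \/
    diamond_dist x y + level y <= (coef y (rcons p b)).*2 + level x].
Proof.
have [e xe] := vertex_on_edge x; have [e' ye] := vertex_on_edge y.
have to2 (f : edge (diamond k)) z : z = end1 f \/ z = end2 f -> climb z (end2 f).
  by move=> [->|->]; [exact: climb_edge | exact: climb_refl].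
have of1 (f : edge (diamond k)) z : z = end1 f \/ z = end2 f -> climb (end1 f) z.
  by move=> [->|->]; [exact: climb_refl | exact: climb_edge].
case: (edge_trichotomy e e') => [ee|c|c|[v0 [v1 [p [a [b [ab ea eb]]]]]]].
- left; subst e'; case: ye => ->; [right|left]; apply: climb_ascending; auto.
- left; left; apply: climb_ascending.
  exact: climb_trans (to2 _ _ xe) (climb_trans c (of1 _ _ ye)).
- left; right; apply: climb_ascending.
  exact: climb_trans (to2 _ _ ye) (climb_trans c (of1 _ _ xe)).
have at_end f q z : z = end1 f \/ z = end2 f -> edge_in_branch v0 v1 q f ->
    in_branch v0 v1 q z /\
    (coef z q + level v0 = level z \/ coef z q + level z = level v1).
  by move=> zf [_ b1 b2 c]; case: zf => ->; tauto.
have [[v0x xv1 xs] cx] := at_end _ _ _ xe ea.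
have [[v0y yv1 ys] cy] := at_end _ _ _ ye eb.
have d0 := graph_dist_le (path_of_length_trans
  (path_of_length_sym (climb_path v0x)) (climb_path v0y)).
have d1 := graph_dist_le (path_of_length_trans
  (climb_path xv1) (path_of_length_sym (climb_path yv1))).
have := (climb_level v0x, climb_level v0y, climb_level xv1, climb_level yv1).
rewrite -/(diamond_dist _ _) in d0 d1.
move=> [[[l1 l2] l3] l4]; right; exists p, a, b; split=> //; lia.
Qed.

(** * A compatible ordering *)

Lemma in_fset_seq (s : seq nat) i : (i \in [fset c in s]%fset) = (i \in s).
Proof. by rewrite inE. Qed.

Lemma path_ltn_last x s : path ltn x s -> x <= last x s ?= iff nilp s.
Proof.
elim: s x => [|y s IHs] x /=; first by move=> _; apply/leqifP; rewrite eqxx.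
move=> /andP[xy /IHs[ys _]]; apply/leqifP => /=; exact: leq_trans xy ys.
Qed.

Lemma fset_max_leP (B : {fset nat}) m :
  reflect (forall i, i \in B -> i <= m) (fset_max B <= m).
Proof.
apply: (iffP (bigmax_leqP_seq _ _ _ _)) => H i iB; last by move=> _; exact: H.
exact: H.
Qed.

Lemma path_ltn_gt x s i : path ltn x s -> i \in s -> x < i.
Proof. by move=> /(order_path_min ltn_trans)/allP; apply. Qed.

Lemma path_ltn_le_last x s i : path ltn x s -> i \in s -> i <= last x s.
Proof.
move=> xs i_s; case/splitPr: i_s xs => s1 s2.
by rewrite cat_path last_cat /= => /and3P[_ _ /path_ltn_last[]].
Qed.

Lemma fset_max_seq l : path ltn 0 l -> fset_max [fset c in l]%fset = last 0 l.
Proof.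
move=> l0; apply/eqP; rewrite eqn_leq; apply/andP; split.
  by apply/fset_max_leP => i; rewrite in_fset_seq; exact: path_ltn_le_last.
case/lastP: l l0 => // s a _; rewrite last_rcons.
have /fset_max_leP := leqnn (fset_max [fset c in rcons s a]%fset); apply.
by rewrite in_fset_seq mem_rcons mem_head.
Qed.

Lemma subsets_le_seq n l :
  path ltn 0 l -> size l <= n -> subsets_le n [fset c in l]%fset.
Proof.
move=> l0 ln; split; first by apply/negP; rewrite in_fset_seq => /(path_ltn_gt l0).
by rewrite card_fseq (leq_trans (size_undup _)).
Qed.

(** Translates index sets of the tree back into the labels used by [coef]. *)
Definition sorted_label (B : {fset nat}) : seq nat := sort leq (enum_fset B).

Lemma sorted_labelK B : [fset c in sorted_label B]%fset = B.
Proof. by apply/fsetP => i; rewrite in_fset_seq mem_sort. Qed.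

Lemma sorted_label_increasing (B : {fset nat}) :
  0 \notin B -> path ltn 0 (sorted_label B).
Proof.
move=> B0; have: sorted ltn (sorted_label B).
  by rewrite ltn_sorted_uniq_leq sort_uniq fset_uniq sort_sorted //; exact: leq_total.
case E: (sorted_label B) => [|a s] //= ->; rewrite andbT lt0n.
have : a \in sorted_label B by rewrite E mem_head.
by rewrite mem_sort; apply: contraTneq => ->.
Qed.

Lemma sorted_label_seq l : path ltn 0 l -> sorted_label [fset c in l]%fset = l.
Proof.
move=> l0; apply: (irr_sorted_eq ltn_trans ltnn).
- apply/(@path_sorted _ _ 0)/sorted_label_increasing.
  by apply/negP; rewrite in_fset_seq => /(path_ltn_gt l0).
- exact: path_sorted l0.
- by move=> i; rewrite mem_sort inE.
Qed.

Section CompatibleOrdering.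
Variable n : nat.

(* [bounded_sets M] is a prefix of [bounded_sets M.+1]: new sets are appended
   in the order of their maxima. *)
Fixpoint bounded_sets (M : nat) : seq {fset nat} :=
  if M is M'.+1 then
    bounded_sets M' ++
    [seq B <- enum_fset (fpowerset [fset i in iota 1 M])%fset |
      (B \notin bounded_sets M') && (#|` B| <= n)]
  else [:: fset0].

Lemma mem_bounded_sets M B :
  B \in bounded_sets M <-> subsets_le n B /\ fset_max B <= M.
Proof.
elim: M => [|M IHM] /=.
  rewrite inE; split=> [/eqP->|[[B0 _] /fset_max_leP BM]].
    by split; first split; rewrite ?inE ?cardfs0 //; apply/fset_max_leP => i; rewrite inE.
  apply/eqP/fsetP => i; rewrite inE; apply/negbTE/negP => iB.
  by have := BM i iB; rewrite leqn0 => /eqP i0; rewrite i0 (negPf B0) in iB.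
rewrite mem_cat mem_filter.
have -> : (B \in enum_fset (fpowerset [fset i in iota 1 M.+1]))%fset =
   (B \in fpowerset [fset i in iota 1 M.+1])%fset by [].
rewrite fpowersetE; split.
  case/orP => [/IHM[? BM]|]; first by split=> //; exact: leqW.
  move=> /andP[/andP[_ Bn] /fsubsetP BM]; split; first split=> //.
    by apply/negP => /BM; rewrite in_fset_seq mem_iota.
  by apply/fset_max_leP => i /BM; rewrite in_fset_seq mem_iota; lia.
move=> [[B0 Bn] /fset_max_leP BM].
suff -> : (B `<=` [fset i in iota 1 M.+1])%fset by rewrite Bn !andbT orbN.
apply/fsubsetP => i iB; rewrite in_fset_seq mem_iota add1n ltnS BM // andbT lt0n.
by apply: contraNneq B0 => <-.
Qed.

Lemma bounded_sets_uniq M : uniq (bounded_sets M).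
Proof.
elim: M => //= M IHM; rewrite cat_uniq IHM filter_uniq ?fset_uniq // andbT /=.
by apply/hasPn => B; rewrite mem_filter => /andP[/andP[]].
Qed.

Lemma bounded_sets_prefix M M' : M <= M' -> prefix (bounded_sets M) (bounded_sets M').
Proof.
move=> /subnKC <-; elim: (M' - M) => [|d IHd]; first by rewrite addn0 prefix_refl.
by rewrite addnS; apply: prefix_trans IHd (prefix_prefix _ _).
Qed.

Lemma nth_bounded_sets M M' i : M <= M' -> i < size (bounded_sets M) ->
  nth fset0 (bounded_sets M') i = nth fset0 (bounded_sets M) i.
Proof. by move=> /bounded_sets_prefix/prefixP[s ->] iM; rewrite nth_cat iM. Qed.

Hypothesis n_gt0 : 0 < n.

(** Stage M + 1 adds at least the singleton of M + 1, which is admissible as [n] is positive. *)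
Lemma size_bounded_sets M : M < size (bounded_sets M).
Proof.
elim: M => //= M IHM; rewrite size_cat -addn1 leq_add // size_filter -has_count.
apply/hasP; exists [fset M.+1]%fset.
  rewrite -[_ \in _]/([fset M.+1] \in fpowerset [fset i in iota 1 M.+1])%fset fpowersetE.
  by apply/fsubsetP => i; rewrite inE => /eqP ->; rewrite in_fset_seq mem_iota; lia.
rewrite cardfs1 n_gt0 andbT; apply/negP => /mem_bounded_sets[_ /fset_max_leP/(_ M.+1)].
by rewrite inE ltnn => /(_ (eqxx _)).
Qed.

(** Stage [i] already has more than [i] entries and later stages only append, so this reads off the
    limit of the stages. *)
Definition enum_sets (i : nat) : {fset nat} := nth fset0 (bounded_sets i) i.

Lemma enum_setsE M i : i < size (bounded_sets M) ->
  enum_sets i = nth fset0 (bounded_sets M) i.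
Proof.
move=> iM; case: (leqP M i) => [Mi|/ltnW Mi]; first exact: nth_bounded_sets.
by rewrite (nth_bounded_sets Mi) // size_bounded_sets.
Qed.

Lemma enum_sets_compatible : compatible_ordering n enum_sets.
Proof.
have mem_enum i : enum_sets i \in bounded_sets i by rewrite mem_nth // size_bounded_sets.
have enumP B : subsets_le n B -> forall M, fset_max B <= M ->
    index B (bounded_sets M) < size (bounded_sets M) /\
    enum_sets (index B (bounded_sets M)) = B.
  move=> Bn M BM; have BM' : B \in bounded_sets M by apply/mem_bounded_sets.
  have iM : index B (bounded_sets M) < size (bounded_sets M) by rewrite index_mem.
  by rewrite (enum_setsE iM) nth_index.
have inj : injective enum_sets.
  move=> i j; wlog ij : i j / i <= j => [th|].
    by case: (leqP i j) => [|/ltnW] ij E; [|symmetry]; apply: th.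
  have iM : i < size (bounded_sets j) := leq_ltn_trans ij (size_bounded_sets j).
  rewrite (enum_setsE iM) (enum_setsE (size_bounded_sets j)) => /eqP.
  by rewrite nth_uniq ?bounded_sets_uniq ?size_bounded_sets // => /eqP.
split.
  split.
  - by move=> i _; have /mem_bounded_sets[] := mem_enum i.
  - by move=> i j _ _; exact: inj.
  - move=> B Bn; have [_ E] := enumP B Bn _ (leqnn _).
    by exists (index B (bounded_sets (fset_max B))).
(* The set at [i] is listed by the stage of its own maximum, whereas the set at [j] is too large to
   belong to that stage. *)
move=> i j lt_ij; have /mem_bounded_sets[sub_i _] := mem_enum i.
have [iM Ei] := enumP _ sub_i _ (leqnn _); move/inj: Ei iM => -> iM.
apply: leq_trans iM _; rewrite leqNgt; apply/negP => jM.
have : enum_sets j \in bounded_sets (fset_max (enum_sets i)).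
  by rewrite (enum_setsE jM) mem_nth.
by move=> /mem_bounded_sets[_]; rewrite leqNgt lt_ij.
Qed.

End CompatibleOrdering.

(** * The embedding *)

Lemma coef_label k (x : vertex (diamond k)) l : 0 < coef x l ->
  path ltn 0 l /\ size l <= k.
Proof.
move=> xl; have [e xe] := vertex_on_edge x.
have /coef_prefix : 0 < coef (end1 e) l + coef (end2 e) l.
  by case: xe xl => ->; lia.
move=> le; split; last by rewrite -(size_edge_label e) size_prefix.
by case/prefixP: le (edge_label_increasing e) => s ->; rewrite cat_path => /andP[].
Qed.

Lemma prefix_last l l' : path ltn 0 l' -> prefix l l' ->
  last 0 l <= last 0 l' ?= iff (l == l').
Proof.
move=> + /prefixP[s El']; rewrite El' cat_path last_cat => /andP[_ /path_ltn_last].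
by have -> : (l == l ++ s) = nilp s by
  rewrite -{1}[l]cats0 eqseq_cat // eqxx; case: (s).
Qed.

Local Open Scope ring_scope.

Fixpoint diamond_map (R : pzRingType) (V : lmodType R) (T : seq nat -> V)
    (k : nat) : vertex (diamond k) -> V :=
  match k return vertex (diamond k) -> V with
  | 0 => fun v : bool => if v then T [::] else 0
  | k'.+1 => fun v : vertex (diamond k') + edge (diamond k') * nat =>
      match v with
      | inl u => diamond_map T u *+ 2
      | inr (e, i) => diamond_map T (end1 e) + diamond_map T (end2 e) +
          T (rcons (edge_label e) (last 0%N (edge_label e) + i.+1)%N)
      end
  end.

Section DiamondMap.
Variables (R : realType) (V : normedModType R) (T : seq nat -> V).

(** Both ends of an edge are expanded in the same k + 1 vectors of one branch, so their difference
    falls under the branch estimate of the tree. *)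
Lemma diamond_map_edge k (e : edge (diamond k)) x : x = end1 e \/ x = end2 e ->
  diamond_map T x =
    \sum_(i < k.+1) (coef x (take i (edge_label e)))%:R *: T (take i (edge_label e)).
Proof.
elim: k e x => [|k IHk] e x.
  by case=> ->; rewrite big_ord1 /= ?scale0r ?scale1r.
case: e => [[e i] h] xe.
have E1 := IHk e _ (or_introl (erefl _)); have E2 := IHk e _ (or_intror (erefl _)).
set q := rcons (edge_label e) (last 0%N (edge_label e) + i.+1)%N.
have qE : @edge_label k.+1 (e, i, h) = q by [].
have sq : size q = k.+1 by rewrite size_rcons size_edge_label.
have tq (j : 'I_k.+1) : take j q = take j (edge_label e).
  by rewrite /q -cats1 takel_cat // size_edge_label -ltnS.
have ntq (j : 'I_k.+1) : (take j q == q) = false.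
  by apply/eqP => /(congr1 size); rewrite size_take_min sq; have := ltn_ord j; lia.
have q0 (u : vertex (diamond k)) : coef u q = 0%N by apply: coef_label_oversize; rewrite sq.
have tsq : take k.+1 q = q by rewrite -sq take_size.
rewrite qE big_ord_recr [nat_of_ord _]/= tsq; under eq_bigr do rewrite [nat_of_ord _]/=.
have inlE (u : vertex (diamond k)) : u = end1 e \/ u = end2 e ->
   diamond_map T (inl u : vertex (diamond k.+1)) =
   \sum_(j < k.+1) (coef (inl u : vertex (diamond k.+1)) (take j q))%:R *: T (take j q) +
   (coef (inl u : vertex (diamond k.+1)) q)%:R *: T q.
  move=> ue; rewrite /= q0 scale0r addr0 (IHk e _ ue) -sumrMnl; apply: eq_bigr => j _.
  by rewrite tq -muln2 mulrnA scalerMnl.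
have inrE : diamond_map T (inr (e, i) : vertex (diamond k.+1)) =
   \sum_(j < k.+1) (coef (inr (e, i) : vertex (diamond k.+1)) (take j q))%:R *: T (take j q) +
   (coef (inr (e, i) : vertex (diamond k.+1)) q)%:R *: T q.
  rewrite /= !q0 eqxx scale1r -/q E1 E2 -big_split /=; congr (_ + _).
  by apply: eq_bigr => j _; rewrite ntq addn0 natrD scalerDl tq.
by case: h xe {qE} => -[->|->]; [exact: inrE | apply: inlE; right |
  apply: inlE; left | exact: inrE].
Qed.

(** A functional that is 1 at the root and kills the other nodes turns the recursion of
    [diamond_map] into that of [level]. *)
Lemma diamond_map_eval (f : {linear V -> R^o}) n k (x : vertex (diamond k)) :
  f (T [::]) = 1 ->
  (forall l, path ltn 0%N l -> (0 < size l <= n)%N -> f (T l) = 0) ->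
  (k <= n)%N -> f (diamond_map T x) = (level x)%:R.
Proof.
move=> f1 f0; elim: k x => [|k IHk] x kn; first by case: x => //=; rewrite linear0.
case: x => [u|[e i]]; first by rewrite level_inl -muln2 mulrnA -(IHk u (ltnW kn)) /= linearMn.
rewrite level_inr /= !linearD /= !IHk ?(ltnW kn) // level_edge f0 ?addr0.
- by rewrite -natrD; congr _%:R; lia.
- exact: (@edge_label_increasing k.+1 (e, i, true)).
- by rewrite size_rcons size_edge_label.
Qed.

(** The threshold [N0] allows the images of two vertices to be expanded up to a common length. *)
Lemma diamond_map_enum n (A : nat -> {fset nat}) (y : {fset nat} -> V) k
    (x : vertex (diamond k)) :
  compatible_ordering n A -> (forall l, T l = y [fset c in l]%fset) -> (k <= n)%N ->
  exists N0, forall N, (N0 <= N)%N ->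
    diamond_map T x = \sum_(m < N) (coef x (sorted_label (A m)))%:R *: y (A m).
Proof.
move=> [[_ injA surjA] _] TE.
have enumT l : path ltn 0%N l -> (size l <= n)%N ->
    exists N0, forall N, (N0 <= N)%N ->
    T l = \sum_(m < N) (sorted_label (A m) == l)%:R *: y (A m).
  move=> l0 ln; have [m0 _ Am0] := surjA _ (subsets_le_seq l0 ln).
  exists m0.+1 => N m0N; rewrite (bigD1 (Ordinal m0N)) //= Am0 sorted_label_seq //.
  rewrite eqxx scale1r -TE big1 ?addr0 // => m mm0.
  case: eqP => [Am|]; last by rewrite scale0r.
  case/eqP: mm0; apply/val_inj/injA; rewrite ?inE //.
  by rewrite Am0 -Am sorted_labelK.
elim: k x => [|k IHk] x kn.
  case: x; last by exists 0%N => N _; rewrite big1 // => m _; rewrite scale0r.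
  have [N0 H] := enumT [::] isT isT; exists N0 => N /H /= ->.
  by apply: eq_bigr => m _; rewrite -size_eq0.
case: x => [u|[e i]].
  have [N0 H] := IHk u (ltnW kn); exists N0 => N /H /= ->.
  by rewrite -sumrMnl; apply: eq_bigr => m _; rewrite -muln2 mulrnA scalerMnl.
have [N1 H1] := IHk (end1 e) (ltnW kn); have [N2 H2] := IHk (end2 e) (ltnW kn).
have [|N3 H3] := enumT _ (@edge_label_increasing k.+1 (e, i, true)).
  by rewrite size_edge_label.
exists (maxn N1 (maxn N2 N3)) => N; rewrite !geq_max => /and3P[/H1 E1 /H2 E2 /H3 E3].
rewrite [LHS]/= -/(@edge_label k.+1 (e, i, true)) E1 E2 E3 -!big_split /=.
by apply: eq_bigr => m _; rewrite !natrD !scalerDl.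
Qed.

End DiamondMap.

(** * Functionals of norm one and the estimates for the map of a good tree *)

Lemma dual_unit_sphere_le (R : realType) (X : normedModType R)
    (f : {linear X -> R^o}) v : dual_unit_sphere f -> `|f v| <= `|v|.
Proof.
move=> [_ f1]; set E := [set `|f w| | w in [set w : X | `|w| <= 1]]%classic.
have [->|v0] := eqVneq v 0; first by rewrite linear0 !normr0.
(* Without a genuine supremum [sup] takes the default value 0, which contradicts dual norm 1. *)
have supE : has_sup E.
  by apply: contrapT => /sup_out E0; move: f1; rewrite /dual_norm E0 => /eqP; rewrite eq_sym oner_eq0.
have v_gt0 : 0 < `|v| by rewrite normr_gt0.
have : `|f (`|v|^-1 *: v)| <= 1.
  rewrite -f1; apply: sup_upper_bound => //; exists (`|v|^-1 *: v) => //=.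
  by rewrite normrZ normfV normr_id mulVf // gt_eqF.
by rewrite linearZ /= normrM normfV normr_id mulrC ler_pdivrMr // mul1r.
Qed.

Lemma prefix_rcons_cases (T : eqType) (l p : seq T) a :
  prefix l (rcons p a) -> l = rcons p a \/ prefix l p.
Proof.
move=> lpa; have := size_prefix lpa; rewrite size_rcons leq_eqVlt => /orP[/eqP sl|sl].
  by left; move: lpa; rewrite prefixE sl -(size_rcons p a) take_size => /eqP.
by right; move: lpa; rewrite !prefixE -cats1 takel_cat.
Qed.

Section GoodTreeMap.
Variables (R : realType) (Y : normedModType R) (k : nat) (C D K : R).
Variables (A : nat -> {fset nat}) (y : {fset nat} -> Y).
Variable ys : {fset nat} -> {linear Y -> R^o}.
Hypothesis A_ord : compatible_ordering k A.
Hypothesis tree : good_linf_tree C D k A y ys.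
Hypothesis K_ge0 : 0 <= K.
Hypothesis tail : forall (c : nat -> R) (m N : nat), (m < N)%N ->
  `|\sum_(m <= j < N) c j *: y (A j)| <= K * `|\sum_(0 <= j < N) c j *: y (A j)|.

Let Psi : vertex (diamond k) -> Y :=
  diamond_map (fun l : seq nat => y [fset c in l]%fset) (k := k).

Lemma edge_upper (e : edge (diamond k)) : `|Psi (end1 e) - Psi (end2 e)| <= C.
Proof.
pose a i : R := (coef (end1 e) (take i (edge_label e)))%:R -
  (coef (end2 e) (take i (edge_label e)))%:R.
have := good_branches tree a (edge_label_increasing e) (size_edge_label e).
rewrite /= => -[_ H].
have -> : Psi (end1 e) - Psi (end2 e) =
    \sum_(i < k.+1) a i *: y [fset c in take i (edge_label e)]%fset.
  rewrite /Psi !(diamond_map_edge _ (e := e)); [|by right|by left].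
  by rewrite -sumrB; apply: eq_bigr => i _; rewrite -scalerBl.
have a1 : \big[Num.max/0]_(i < k.+1) `|a i| <= 1.
  apply: bigmax_le => // i _; have [] := coef_edge e (take i (edge_label e)).
  by rewrite -!(ler_nat R) /a !mulrS ler_norml; lra.
(* A negative [C] is excluded by the upper branch estimate with all coefficients equal to 1. *)
apply: le_trans H _; have [C0|C0] := leP 0 C; first by rewrite ler_piMr.
have [_] := good_branches tree (fun=> 1) (edge_label_increasing e) (size_edge_label e).
rewrite /=; set v := \sum_(i < _) _; set M := \big[Num.max/0]_(i < _) _.
have M1 : 1 <= M.
  by rewrite /M (le_trans _ (le_bigmax _ _ ord0)) // normr1.
by have := normr_ge0 v; nra.
Qed.

Lemma Psi_upper (u v : vertex (diamond k)) :
  `|Psi u - Psi v| <= C * (diamond_dist u v)%:R.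
Proof.
have [s [us sv <-]] := diamond_connected u v.
elim: s u us sv => [|w s IHs] u /=; first by move=> _ ->; rewrite subrr normr0 mulr0.
move=> /andP[/asboolP uw ws] /(IHs _ ws) H.
rewrite mulrS mulrDr mulr1 (le_trans (ler_distD (Psi w) _ _)) // lerD //.
by case: uw => e [[-> ->]|[-> ->]]; [|rewrite distrC]; exact: edge_upper.
Qed.

(** The root functional has norm one and kills every nonempty node, whose maximum is positive. *)
Lemma Psi_level (u v : vertex (diamond k)) :
  `|(level u)%:R - (level v)%:R| <= `|Psi u - Psi v|.
Proof.
have sub0 := @subsets_le_seq k [::] isT (leq0n k).
have le_f := dual_unit_sphere_le _ (good_functionals tree sub0).
have fy := good_diagonal tree sub0.
set f := ys _ in le_f; suff E w : f (Psi w) = (level w)%:R by rewrite -!E -linearB.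
apply: (@diamond_map_eval _ _ _ _ k) => //.
move=> l l0 /andP[l_gt0 lk]; apply: (good_vanishing tree) => //.
  exact: subsets_le_seq.
rewrite !fset_max_seq //=; case: l l0 l_gt0 {lk} => //= a l /andP[a0 /path_ltn_last[al _]] _.
exact: leq_trans a0 al.
Qed.

(* Cutting the series at the node [rcons p a] removes the common nodes, which all
   have a smaller maximum; the functional of [rcons p a] kills every other node
   of the tail, where the maximum exceeds [a]. *)
Lemma Psi_branch (u v : vertex (diamond k)) p a b : (a < b)%N ->
  (forall l, (0 < coef u l)%N -> comparable_label l (rcons p a)) ->
  (forall l, (0 < coef v l)%N -> comparable_label l (rcons p b)) ->
  (coef u (rcons p a))%:R <= K * `|Psi u - Psi v|.
Proof.
move=> ab su sv; set q := rcons p a.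
have [->|uq] := posnP (coef u q); first by rewrite mulr_ge0.
have [q0 qk] := coef_label uq.
have [[Asub injA surjA] ordA] := A_ord.
have sub_q := subsets_le_seq q0 qk.
have [m0 _ Am0] := surjA _ sub_q.
have TE (l : seq nat) : (fun l : seq nat => y [fset c in l]%fset) l =
    y [fset c in l]%fset by [].
have [Nu Hu] := diamond_map_enum u A_ord TE (leqnn k).
have [Nv Hv] := diamond_map_enum v A_ord TE (leqnn k).
(* Long enough for both expansions and for the node [q], which sits at index [m0]. *)
pose N := maxn m0.+1 (maxn Nu Nv).
pose c m : R := (coef u (sorted_label (A m)))%:R - (coef v (sorted_label (A m)))%:R.
have PsiB : Psi u - Psi v = \sum_(0 <= m < N) c m *: y (A m).
  rewrite /Psi (Hu N) ?(Hv N) ?leq_max ?leqnn ?orbT // -sumrB big_mkord.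
  by apply: eq_bigr => m _; rewrite scalerBl.
have m0N : (m0 < N)%N by rewrite leq_max leqnn.
have := tail c m0N; rewrite -PsiB; apply: le_trans.
(* Comparable labels of equal length coincide, but [a] differs from [b]. *)
have vq : coef v q = 0%N.
  apply/eqP; rewrite -leqn0 leqNgt; apply/negP => /sv.
  have eq_size : size q = size (rcons p b) by rewrite !size_rcons.
  move=> qb; have : q == rcons p b.
    case/orP: qb; rewrite prefixE; last by rewrite -eq_size take_size.
    by rewrite eq_size take_size eq_sym.
  by rewrite /q eqseq_rcons eqxx /= ltn_eqF.
apply: le_trans (dual_unit_sphere_le _ (good_functionals tree sub_q)).
rewrite big_ltn // linearD linearZ /= linear_sum big_nat_cond big1 => [|m].
  rewrite addr0 Am0 (good_diagonal tree sub_q) /c Am0 sorted_label_seq // vq subr0.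
  by rewrite [_ *: _]mulr1 ler_norm.
rewrite andbT => /andP[m0m mN]; rewrite linearZ /=.
have sub_m : subsets_le k (A m) by exact: Asub.
have [l0 lk] : path ltn 0%N (sorted_label (A m)) /\
    A m = [fset c in sorted_label (A m)]%fset.
  by rewrite sorted_labelK; split=> //; apply: sorted_label_increasing; case: sub_m.
(* Compatibility yields only a weak inequality of maxima for later nodes; the strict one is obtained
   below when the coefficient is nonzero. *)
have qm : (last 0%N q <= last 0%N (sorted_label (A m)))%N.
  rewrite -!fset_max_seq // -lk -Am0 leqNgt; apply/negP => /ordA.
  by rewrite ltnNge ltnW.
have qNm : sorted_label (A m) != q.
  apply/eqP => E; have : m = m0 by apply: injA; rewrite ?inE // lk E Am0.
  by move=> mm; rewrite mm ltnn in m0m.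
have [c0|c0] := eqVneq (c m) 0; first by rewrite c0 scale0r.
have p_small l : path ltn 0%N l -> prefix l p -> (last 0%N l < last 0%N q)%N.
  move=> l0' lp; have lq := prefix_trans lp (prefix_rcons p a).
  have [Hle Heq] := prefix_last q0 lq; rewrite ltn_neqAle Hle Heq andbT.
  by apply/eqP => E; have := size_prefix lp; rewrite E size_rcons ltnn.
suff lt_m : (last 0%N q < last 0%N (sorted_label (A m)))%N.
  rewrite (good_vanishing tree sub_q sub_m) ?scaler0 //.
  by rewrite lk !fset_max_seq.
have not_p : ~~ prefix (sorted_label (A m)) p.
  by apply/negP => /(p_small _ l0); rewrite ltnNge qm.
(* A node used by [u] is a prefix of [p] (maximum too small), [q] itself (only at [m0]) or a proper
   extension of [q]. One used by [v] is a prefix of [p] or has maximum at least [b], which exceeds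
   [a]. *)
have [u0|/su/orP[/prefix_rcons_cases[E|E]|ql]] := posnP (coef u (sorted_label (A m))).
- have /sv/orP vb : (0 < coef v (sorted_label (A m)))%N.
    by rewrite lt0n; apply: contra_neq c0 => v0; rewrite /c u0 v0 subrr.
  rewrite /q last_rcons; case: vb => [/prefix_rcons_cases[->|E]|bl].
  + by rewrite last_rcons.
  + by rewrite E in not_p.
  + by have [+ _] := prefix_last l0 bl; rewrite last_rcons; exact: leq_trans.
- by rewrite E eqxx in qNm.
- by rewrite E in not_p.
- by have [le_q eq_q] := prefix_last l0 ql; rewrite ltn_neqAle le_q eq_q eq_sym qNm.
Qed.

Lemma Psi_lower_vertical (u v : vertex (diamond k)) :
  same_vertical_path u v -> (diamond_dist u v)%:R <= `|Psi u - Psi v|.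
Proof.
wlog uv : u v / ascending_path u v => [th|_].
  case=> uv; first by apply: th => //; left.
  by rewrite diamond_dist_sym distrC; apply: th => //; left.
apply: le_trans (Psi_level u v); rewrite distrC.
have := ascending_dist uv; rewrite -(ler_nat R) natrD => le_uv.
by apply: le_trans (ler_norm _); rewrite lerBrDl.
Qed.

Lemma Psi_lower (u v : vertex (diamond k)) : ~ same_vertical_path u v ->
  (diamond_dist u v)%:R <= (2 * K + 1) * `|Psi u - Psi v|.
Proof.
move=> Nuv; have [//|[p [a [b [ab su sv du dv]]]]] := vertex_dichotomy u v.
have := Psi_level u v; rewrite ler_norml => /andP[lvl1 lvl2].
have bound c : (diamond_dist u v + level u <= c.*2 + level v)%N \/
      (diamond_dist u v + level v <= c.*2 + level u)%N ->
    c%:R <= K * `|Psi u - Psi v| -> 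
    (diamond_dist u v)%:R <= (2 * K + 1) * `|Psi u - Psi v|.
  by case; rewrite -(ler_nat R) -muln2 !natrD natrM; lra.
(* The coefficient is extracted on the branch with the smaller new entry, so that its functional
   kills the other branch. *)
have [ab'|ba|E] := ltngtP a b; last by rewrite E eqxx in ab.
  exact: bound du (Psi_branch ab' su sv).
by apply: bound dv _; rewrite distrC; exact: Psi_branch ba sv su.
Qed.
End GoodTreeMap.

(** * Conclusion: the tail constants in the two cases *)

Lemma good_tree_map (R : realType) (Y : normedModType R) (k : nat) (C D K : R)
    (A : nat -> {fset nat}) (y : {fset nat} -> Y)
    (ys : {fset nat} -> {linear Y -> R^o}) :
  compatible_ordering k A -> good_linf_tree C D k A y ys -> 0 <= K ->
  (forall (c : nat -> R) (m N : nat), (m < N)%N ->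
    `|\sum_(m <= j < N) c j *: y (A j)| <=
    K * `|\sum_(0 <= j < N) c j *: y (A j)|) ->
  exists Psi : vertex (diamond k) -> Y, forall u v : vertex (diamond k),
    [/\ `|Psi u - Psi v| <= C * (diamond_dist u v)%:R,
      same_vertical_path u v -> (diamond_dist u v)%:R <= `|Psi u - Psi v| &
      ~ same_vertical_path u v ->
      (diamond_dist u v)%:R <= (2 * K + 1) * `|Psi u - Psi v|].
Proof.
move=> A_ord tree K_ge0 tail.
exists (diamond_map (fun l : seq nat => y [fset c in l]%fset) (k := k)) => u v.
split; first exact: (Psi_upper tree).
  exact: (Psi_lower_vertical tree).
exact: (Psi_lower A_ord tree).
Qed.

Theorem theorem3p1 (R : realType) (Y : completeNormedModType R)
    (hY : contains_good_linf_trees_almost_isometrically Y) :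
  (forall (eps : R) (k : nat), 0 < eps -> (0 < k)%N ->
    exists Psi : vertex (diamond k) -> Y, forall x y : vertex (diamond k),
      (same_vertical_path x y ->
        (diamond_dist x y)%:R <= `|Psi x - Psi y| /\
        `|Psi x - Psi y| <= (1 + eps) * (diamond_dist x y)%:R) /\
      (~ same_vertical_path x y ->
        (diamond_dist x y)%:R / (6 * (1 + eps)) <= `|Psi x - Psi y| /\
        `|Psi x - Psi y| <= (1 + eps) * (diamond_dist x y)%:R)) /\
  (contains_bimonotone_good_linf_trees_almost_isometrically Y ->
   forall (eps : R) (k : nat), 0 < eps -> (0 < k)%N ->
    exists Psi : vertex (diamond k) -> Y, forall x y : vertex (diamond k),
      (same_vertical_path x y ->
        (diamond_dist x y)%:R <= `|Psi x - Psi y| /\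
        `|Psi x - Psi y| <= (1 + eps) * (diamond_dist x y)%:R) /\
      (~ same_vertical_path x y ->
        (diamond_dist x y)%:R / 3 <= `|Psi x - Psi y| /\
        `|Psi x - Psi y| <= (1 + eps) * (diamond_dist x y)%:R)).
Proof.
split=> [|bY] eps k eps0 k0; have A_ord := enum_sets_compatible k0.
  have [y [ys tree]] := hY eps eps0 k _ k0 A_ord.
  (* A tail is the whole sum minus an initial sum, of norms at most 1 and 1 + eps times that of the
     whole. *)
  have [|c m N mN|Psi PsiP] := @good_tree_map _ _ _ _ _ (2 + eps) _ _ _ A_ord tree.
  - by rewrite addr_ge0 ?ltW.
  - have /= := good_basis tree c (ltnW mN).
    rewrite -!(big_mkord xpredT (fun j => c j *: y (enum_sets k j))).
    have -> := big_cat_nat (leq0n m) (ltnW mN) (P := xpredT)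
      (F := fun j => c j *: y (enum_sets k j)) (op := +%R) (idx := 0 : Y).
    rewrite /=; set s := \sum_(0 <= j < m) _; set t := \sum_(m <= j < N) _ => s_le.
    have : `|t| <= `|s + t| + `|s|.
      by rewrite -[X in `|X| <= _](addKr s) addrC (le_trans (ler_normB _ _)).
    lra.
  exists Psi => u v; have [upper vert nvert] := PsiP u v.
  split=> [/vert //|/nvert le_d]; split=> //.
  (* Here 2 K + 1 = 5 + 2 eps, which is at most 6 (1 + eps). *)
  rewrite ler_pdivrMr; last by lra.
  have := normr_ge0 (Psi u - Psi v); nra.
have [y [ys [tree [_ bim]]]] := bY eps eps0 k _ k0 A_ord.
(* Bimonotonicity bounds tails with K = 1, whence 2 K + 1 = 3. *)
have [//|c m N mN|Psi PsiP] := @good_tree_map _ _ _ _ _ 1 _ _ _ A_ord tree.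
  by rewrite mul1r; exact: bim.
exists Psi => u v; have [upper vert nvert] := PsiP u v.
split=> [/vert //|/nvert le_d]; split=> //.
by rewrite ler_pdivrMr; lra.
Qed.
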